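(* Let $k\ge 1$ and let $H$ be any finite simple graph with $2k$ vertices and $e$ edges. Then there exists an underlying graph with at most $$2k+2ek-4e+2\binom{2k}{2}$$ vertices that contains $H$ (up to isomorphism) as an induced subgraph.
   Context: A configuration of $n$ points ($n$ even) is a set of $n$ points in $\mathbb{R}^2$ in general position (no three collinear). A halving line of the configuration is a line through two of the points such that exactly $(n-2)/2$ of the remaining $n-2$ points lie on each side of it. The underlying graph of the configuration is the graph whose vertices are the $n$ points, two vertices being adjacent if and only if the line through the corresponding two points is a halving line. An underlying graph is a graph arising in this way from some configuration with an even number of points. A subgraph $H$ of $G$ is induced if any two vertices of $H$ are adjacent in $H$ if and only if they are adjacent in $G$. *)

(* Defs.v *)
From HB Require Import structures.
From mathcomp Require Import all_boot all_order all_algebra.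
From mathcomp Require Import reals.

Set Implicit Arguments.
Unset Strict Implicit.
Unset Printing Implicit Defensive.

Import Order.TTheory GRing.Theory Num.Theory.
Local Open Scope ring_scope.

Record sgraph := SGraph {
  vertex :> finType;
  adj : rel vertex;
  adj_sym : symmetric adj;
  adj_irrefl : irreflexive adj }.

Definition edge_set (G : sgraph) : {set {set G}} :=
  [set [set xy.1; xy.2] | xy : G * G & adj xy.1 xy.2].

Definition contains_induced (G H : sgraph) : Prop :=
  exists f : H -> G, injective f /\ forall x y, adj (f x) (f y) = adj x y.

(* The line { x | normal . x = offset }. A line of the plane has several such
   equations; negating one exchanges the two sides. *)
Record line (R : realType) := Line {
  normal : 'rV[R]_2;
  offset : R;
  normal_neq0 : normal != 0 }.

Definition line_eval (R : realType) (l : line R) (x : 'rV[R]_2) : R :=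
  \sum_(i < 2) normal l 0 i * x 0 i - offset l.

Definition on_line (R : realType) (l : line R) (x : 'rV[R]_2) : bool :=
  line_eval l x == 0.

Definition collinear (R : realType) (a b c : 'rV[R]_2) : Prop :=
  exists l : line R, [/\ on_line l a, on_line l b & on_line l c].

(* A set of #|T| points, presented as an injective family indexed by T. *)
Definition configuration (R : realType) (T : finType) (p : T -> 'rV[R]_2)
    : Prop :=
  [/\ ~~ odd #|T|, injective p &
      forall x y z : T, x != y -> y != z -> x != z ->
        ~ collinear (p x) (p y) (p z)].

Definition halving_line (R : realType) (T : finType) (p : T -> 'rV[R]_2)
    (l : line R) : Prop :=
  [/\ exists x y : T, [/\ x != y, on_line l (p x) & on_line l (p y)],
      #|[set z | line_eval l (p z) < 0]| = ((#|T| - 2) %/ 2)%N &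
      #|[set z | 0 < line_eval l (p z)]| = ((#|T| - 2) %/ 2)%N].

Definition halving_pair (R : realType) (T : finType) (p : T -> 'rV[R]_2)
    (x y : T) : Prop :=
  x != y /\
  exists l : line R, [/\ on_line l (p x), on_line l (p y) & halving_line p l].

(* The points are indexed by the vertices of G themselves, so being an
   underlying graph is invariant under isomorphism. *)
Definition underlying_graph (R : realType) (G : sgraph) : Prop :=
  exists p : G -> 'rV[R]_2,
    configuration p /\ forall x y : G, adj x y <-> halving_pair p x y.

(* Main.v *)
Require Import Defs.
From HB Require Import structures.
From mathcomp Require Import all_boot all_order all_algebra.
From mathcomp Require Import reals.
From mathcomp Require Import zify ring lra.

(** The idea is to place the vertices of H so that their connecting lines have
    pairwise distinct directions, and then to repair the lines one at a time.

    A line through two points x and y of a set in general position is halving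
    iff as many points lie to the left of the directed line xy as to the left
    of yx; these two left counts are the only data that matter
    ([halving_graph]).  To push the balance of one line uv, with direction
    d = v - u, add two points on the left of uv, one very far in the direction
    d and one very far in the direction - d ([far_pair]).  Every other
    connecting line crosses the direction d, so it separates the two new points
    and its balance is unchanged; the balance of uv changes by 2.  A finite
    list of such corrections therefore acts independently on the lines
    ([add_far_pairs]).

    It remains to count.  Each line through two of the 2k initial points has
    2k - 2 other points on its sides, so the two left counts differ by an even
    number at most 2k - 2.  An edge of H needs half of this difference, hence
    at most k - 1 corrections, to become halving; a non-edge needs one
    correction if its line happens to be balanced, and none otherwise.  At two
    points per correction the total is at most
    2k + 2 (e (k - 1) + ('C(2k, 2) - e)), which is the required bound.  The
    lines through new points need no attention, because the subgraph on the
    initial points does not see them.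

    Initial points with connecting lines of distinct directions are the points
    of the parabola with abscissas 1, 2, 4, 8, ...: the chord between abscissas
    a and b has slope a + b, and powers of 2 form a Sidon set
    ([base_points]). *)

Set Implicit Arguments.
Unset Strict Implicit.
Unset Printing Implicit Defensive.

Import Order.TTheory GRing.Theory Num.Theory.
Local Open Scope ring_scope.

(** * Orientation and lines of the plane *)

Section Plane.
Variable R : realType.
Implicit Types (a b c d x y z u v p q : 'rV[R]_2) (s : seq 'rV[R]_2).

Definition abscissa x : R := x 0 0.
Definition ordinate x : R := x 0 1.

Definition point (a b : R) : 'rV[R]_2 := \row_(i < 2) if i == 0 then a else b.

Lemma abscissa_point (a b : R) : abscissa (point a b) = a.
Proof. by rewrite /abscissa mxE. Qed.

Lemma ordinate_point (a b : R) : ordinate (point a b) = b.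
Proof. by rewrite /ordinate mxE. Qed.

Lemma point_eq x y :
  (x == y) = (abscissa x == abscissa y) && (ordinate x == ordinate y).
Proof.
apply/eqP/andP => [->|[/eqP ex /eqP ey]]; first by [].
apply/rowP => i; have [->|->] : i = 0 \/ i = 1; last 2 first.
- exact: ex.
- exact: ey.
case: i => [[|[|//]]] hi; [left|right]; exact: val_inj.
Qed.

(** Determinant of the vectors ab and cd: it vanishes iff they are parallel. *)
Definition cross a b c d : R :=
  (abscissa b - abscissa a) * (ordinate d - ordinate c) -
  (ordinate b - ordinate a) * (abscissa d - abscissa c).

(** Positive iff c lies to the left of the directed line ab. *)
Definition orient a b c : R := cross a b a c.

Lemma orient_swap a b c : orient b a c = - orient a b c.
Proof. by rewrite /orient /cross; ring. Qed.

Lemma orient_rot a b c : orient b c a = orient a b c.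
Proof. by rewrite /orient /cross; ring. Qed.

Lemma orient_l a b : orient a b a = 0.
Proof. by rewrite /orient /cross; ring. Qed.

Lemma orient_r a b : orient a b b = 0.
Proof. by rewrite /orient /cross; ring. Qed.

Lemma cross_swap a b c d : cross b a c d = - cross a b c d.
Proof. by rewrite /cross; ring. Qed.

Lemma line_evalE (l : line R) z :
  line_eval l z = normal l 0 0 * abscissa z + normal l 0 1 * ordinate z
                  - offset l.
Proof.
rewrite /line_eval !big_ord_recl big_ord0 addr0.
by have -> : lift ord0 ord0 = 1 :> 'I_2 by exact: val_inj.
Qed.

Lemma connecting_line x y : x != y ->
  exists l : line R, forall z, line_eval l z = orient x y z.
Proof.
move=> nxy.
pose n := point (ordinate x - ordinate y) (abscissa y - abscissa x).
have n0 : n != 0.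
  apply: contraNneq nxy => n0; rewrite point_eq.
  have e0 : abscissa n = 0 by rewrite n0 /abscissa mxE.
  have e1 : ordinate n = 0 by rewrite n0 /ordinate mxE.
  rewrite abscissa_point in e0; rewrite ordinate_point in e1.
  by apply/andP; split; apply/eqP; lra.
exists (Line (abscissa n * abscissa x + ordinate n * ordinate x) n0) => z.
rewrite line_evalE /= -/(abscissa n) -/(ordinate n).
by rewrite abscissa_point ordinate_point /orient /cross; ring.
Qed.

(** The normal of a line through x and y is orthogonal to y - x, hence
    proportional to y - x turned by a right angle; so every equation of the line
    is a multiple of the orientation. *)
Lemma line_eval_orient (l : line R) x y : x != y ->
  on_line l x -> on_line l y ->
  exists2 c : R, c != 0 & forall z, line_eval l z = c * orient x y z.
Proof.
rewrite /on_line !line_evalE => nxy /eqP hx /eqP hy.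
have : (normal l 0 0 != 0) || (normal l 0 1 != 0).
  rewrite -negb_and; apply: contra (normal_neq0 l).
  rewrite (point_eq (normal l) 0) /abscissa /ordinate.
  by move=> /andP[/eqP -> /eqP ->]; rewrite !mxE eqxx.
set n0 := normal l 0 0 in hx hy *; set n1 := normal l 0 1 in hx hy * => hn.
pose d0 := abscissa y - abscissa x; pose d1 := ordinate y - ordinate x.
have hd : n0 * d0 + n1 * d1 = 0 by rewrite /d0 /d1; lra.
have d_neq0 : (d0 != 0) || (d1 != 0).
  by rewrite -negb_and !subr_eq0 eq_sym (eq_sym (ordinate y)) -point_eq.
(* Normal and direction satisfy n . d = 0; the factor is det (d, n) / |d|^2,
   read off from n |d|^2 = (n . d) d + det (d, n) (rotation of d). *)
have D0 : d0 ^+ 2 + d1 ^+ 2 != 0.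
  rewrite paddr_eq0 ?sqr_ge0// !sqrf_eq0 negb_and; exact: d_neq0.
have e0 : n0 * (d0 ^+ 2 + d1 ^+ 2) = - (n1 * d0 - n0 * d1) * d1.
  have -> : n0 * (d0 ^+ 2 + d1 ^+ 2) =
     (n0 * d0 + n1 * d1) * d0 - (n1 * d0 - n0 * d1) * d1 by ring.
  by rewrite hd; ring.
have e1 : n1 * (d0 ^+ 2 + d1 ^+ 2) = (n1 * d0 - n0 * d1) * d0.
  have -> : n1 * (d0 ^+ 2 + d1 ^+ 2) =
     (n0 * d0 + n1 * d1) * d1 + (n1 * d0 - n0 * d1) * d0 by ring.
  by rewrite hd; ring.
exists ((n1 * d0 - n0 * d1) / (d0 ^+ 2 + d1 ^+ 2)).
  rewrite mulf_neq0 ?invr_neq0//; apply: contraTneq hn => c0.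
  move: e0 e1; rewrite c0 oppr0 !mul0r.
  move=> /eqP; rewrite mulf_eq0 (negPf D0) orbF => /eqP ->.
  by move=> /eqP; rewrite mulf_eq0 (negPf D0) orbF => /eqP ->; rewrite eqxx.
move=> z; apply: (mulfI D0); rewrite line_evalE -/n0 -/n1.
have -> : offset l = n0 * abscissa x + n1 * ordinate x by lra.
have -> : forall t : R, (d0 ^+ 2 + d1 ^+ 2) *
  ((n1 * d0 - n0 * d1) / (d0 ^+ 2 + d1 ^+ 2) * t) = (n1 * d0 - n0 * d1) * t.
  by move=> t; field.
have -> : (d0 ^+ 2 + d1 ^+ 2) * (n0 * abscissa z + n1 * ordinate z -
   (n0 * abscissa x + n1 * ordinate x)) =
   n0 * (d0 ^+ 2 + d1 ^+ 2) * (abscissa z - abscissa x) +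
   n1 * (d0 ^+ 2 + d1 ^+ 2) * (ordinate z - ordinate x) by ring.
by rewrite e0 e1 /orient /cross -/d0 -/d1; ring.
Qed.

(** * Left counts and halving lines *)

Definition general_position s : Prop :=
  uniq s /\ {in s & &, forall x y z,
    x != y -> y != z -> x != z -> orient x y z != 0}.

(** Distinctness of the new point is automatic: a point of s lies on a line
    through two points of s, as soon as s has two points. *)
Lemma general_position_cons s u v p : u \in s -> v \in s -> u != v ->
  general_position s -> {in s &, forall x y, x != y -> orient x y p != 0} ->
  general_position (p :: s).
Proof.
move=> us vs nuv [Us gs] hp; split.
  rewrite /= Us andbT; apply/negP => ps.
  have [pu|npu] := eqVneq p u.
    by have := hp _ _ us vs nuv; rewrite pu orient_l eqxx.
  by have := hp _ _ ps us npu; rewrite orient_l eqxx.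
move=> x y z; rewrite !inE.
move=> /predU1P[->|xs] /predU1P[->|ys] /predU1P[->|zs];
  rewrite ?eqxx// => nxy nyz nxz.
- by rewrite -orient_rot; exact: hp.
- by rewrite orient_rot; apply: hp => //; rewrite eq_sym.
- exact: hp.
- exact: gs.
Qed.

Definition left_count x y s : nat := count (fun z => 0 < orient x y z) s.

(** Each point of s other than x and y is on exactly one side of xy, and the
    right of xy is the left of yx. *)
Lemma left_count_sum s x y : general_position s -> x \in s -> y \in s ->
  x != y -> (left_count x y s + left_count y x s + 2)%N = size s.
Proof.
move=> [Us gs] xs ys nxy; rewrite /left_count.
suff <- : (count (fun z => 0 < orient x y z)%R s + count (fun z => 0 < orient y x z)%R s
    + (count_mem x s + count_mem y s))%N = size s by rewrite !count_uniq_mem// xs ys.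
have : {in s, forall z, ((0 < orient x y z)%R + (0 < orient y x z)%R +
    ((z == x) + (z == y)) = 1)%N}.
  move=> z zs; rewrite (orient_swap x) oppr_gt0.
  have [->|nzx] := eqVneq z x; first by rewrite orient_l ltxx (negPf nxy).
  have [->|nzy] := eqVneq z y; first by rewrite orient_r ltxx.
  have := gs x y z xs ys zs nxy; rewrite ![_ == z]eq_sym => /(_ nzy nzx).
  by rewrite neq_lt => /orP[] h; rewrite h (lt_gtF h).
elim: s {Us gs xs ys} => //= z s IHs h1.
have := h1 z (mem_head z s).
have := IHs (fun w ws => h1 w (mem_behead (s := z :: s) ws)).
by lia.
Qed.

Lemma card_seq_sub_count s (P : pred 'rV[R]_2) : uniq s ->
  #|[set z : seq_sub s | P (val z)]| = count P s.
Proof.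
move=> Us.
have /permP <- : perm_eq [seq val z | z : seq_sub s] s.
  apply: uniq_perm => //; first by rewrite map_inj_uniq ?enum_uniq//; exact: val_inj.
  move=> x; apply/mapP/idP => [[z _ ->]|xs]; first exact: valP.
  by exists (SeqSub xs); rewrite ?mem_enum.
by rewrite count_map cardsE cardE size_filter enumT.
Qed.

(** By [left_count_sum], equality of the two left counts forces their common
    value to be half the number of remaining points. *)
Lemma halving_pair_left_count s (x y : seq_sub s) : general_position s ->
  halving_pair val x y <->
  x != y /\ left_count (val x) (val y) s = left_count (val y) (val x) s.
Proof.
move=> gs; have Us := gs.1.
have card_s : #|{: seq_sub s}| = size s by rewrite card_seq_sub.
have sum_s (nxy : x != y) := left_count_sum gs (valP x) (valP y) nxy.
split=> [[nxy [l [lx ly [_ cneg cpos]]]]|[nxy eq_xy]]; split=> //.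
  have nvxy : val x != val y by rewrite (inj_eq val_inj).
  have [c c0 lE] := line_eval_orient nvxy lx ly.
  have eqc := etrans cneg (esym cpos).
  rewrite (card_seq_sub_count (fun z => 0 < line_eval l z))// in eqc.
  rewrite (card_seq_sub_count (fun z => line_eval l z < 0))// in eqc.
  move: c0; rewrite neq_lt => /orP[] c0.
  - have <- : count (fun z => line_eval l z < 0) s = left_count (val x) (val y) s.
      by apply: eq_count => z; rewrite lE nmulr_rlt0.
    rewrite eqc; apply: eq_count => z.
    by rewrite lE nmulr_rgt0// (orient_swap (val x)) oppr_gt0.
  - have <- : count (fun z => 0 < line_eval l z) s = left_count (val x) (val y) s.
      by apply: eq_count => z; rewrite lE pmulr_rgt0.
    rewrite -eqc; apply: eq_count => z.
    by rewrite lE pmulr_rlt0// (orient_swap (val x)) oppr_gt0.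
have nvxy : val x != val y by rewrite (inj_eq val_inj).
have [l lE] := connecting_line nvxy.
have lx : on_line l (val x) by rewrite /on_line lE orient_l.
have ly : on_line l (val y) by rewrite /on_line lE orient_r.
exists l; split=> //; split; first by exists x, y.
- rewrite (card_seq_sub_count (fun z => line_eval l z < 0))// card_s.
  rewrite -(sum_s nxy) addnK -eq_xy addnn -mul2n mulKn// eq_xy.
  by apply: eq_count => z; rewrite lE (orient_swap (val x)) oppr_gt0.
- rewrite (card_seq_sub_count (fun z => 0 < line_eval l z))// card_s.
  rewrite -(sum_s nxy) addnK -eq_xy addnn -mul2n mulKn//.
  by apply: eq_count => z; rewrite lE.
Qed.

(** The adjacency is given by left counts, which makes it a boolean relation;
    the family b of prescribed points is where the induced copy of a given graph
    will sit. *)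
Lemma halving_graph s : general_position s -> ~~ odd (size s) ->
  exists G : sgraph, [/\ underlying_graph R G, #|G| = size s &
    forall (T : eqType) (b : T -> 'rV[R]_2), injective b ->
      (forall x : T, b x \in s) -> exists f : T -> G, injective f /\
        forall x y : T, adj (f x) (f y) =
          (x != y) && (left_count (b x) (b y) s == left_count (b y) (b x) s)].
Proof.
move=> gs even_s.
pose e (x y : seq_sub s) := (x != y) &&
  (left_count (val x) (val y) s == left_count (val y) (val x) s).
have e_sym : symmetric e by move=> x y; rewrite /e eq_sym (eq_sym (left_count _ _ s)).
have e_irr : irreflexive e by move=> x; rewrite /e eqxx.
have card_s : #|{: seq_sub s}| = size s by rewrite card_seq_sub ?gs.1.
exists (SGraph e_sym e_irr); split=> //.
  exists val; split; last first.
    move=> x y; rewrite halving_pair_left_count//.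
    by split=> [/andP[? /eqP]|[? ?]]; last apply/andP; split=> //; apply/eqP.
  split; [by rewrite card_s | exact: val_inj |].
  move=> x y z nxy nyz nxz [l [lx ly lz]].
  have [c c0 lE] := line_eval_orient (nxy : val x != val y) lx ly.
  move: lz; rewrite /on_line lE mulf_eq0 (negPf c0)/=; apply/negP.
  exact: gs.2 (valP x) (valP y) (valP z) nxy nyz nxz.
move=> T b inj_b bs; exists (fun x : T => SeqSub (bs x)); split.
  by move=> x y [/inj_b].
by move=> x y; rewrite /= /e -(inj_eq val_inj) /= (inj_eq inj_b).
Qed.

(** * Balanced pairs of far points *)

Definition eventually (P : R -> Prop) : Prop := exists M, forall t, M < t -> P t.

Lemma eventually_all (I : eqType) (r : seq I) (P : I -> R -> Prop) :
  {in r, forall i, eventually (P i)} ->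
  eventually (fun t => {in r, forall i, P i t}).
Proof.
elim: r => [|i r IHr] hP; first by exists 0.
have [M hM] := hP i (mem_head i r).
have [N hN] : eventually (fun t => {in r, forall i, P i t}).
  by apply: IHr => j jr; apply: hP; rewrite inE jr orbT.
exists (Num.max M N) => t; rewrite gt_max => /andP[Mt Nt] j.
by rewrite inE => /predU1P[->|]; [exact: hM | exact: hN].
Qed.

(** Orientations of a point moving on a parabola are quadratic in the
    parameter, so this and [quadratic_neq0] decide their signs far away. *)
Lemma quadratic_gt0 (a b c : R) : 0 < a ->
  eventually (fun t => 0 < a * t ^+ 2 + b * t + c).
Proof.
move=> a0; exists (1 + (`|b| + `|c|) / a) => t ht.
have t1 : 1 < t.
  by apply: le_lt_trans ht; rewrite lerDl divr_ge0// ?addr_ge0// ltW.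
have hat : `|b| + `|c| < a * t.
  rewrite mulrC -ltr_pdivrMr//; apply: lt_trans ht; lra.
have hb := ler_norm (- b); have hc := ler_norm (- c).
rewrite !normrN in hb hc.
have : 0 < (a * t - `|b| - `|c|) * t by apply: mulr_gt0; lra.
have : 0 <= (`|b| + b) * t by apply: mulr_ge0; lra.
have : 0 <= `|c| * (t - 1) by apply: mulr_ge0 => //; lra.
by nra.
Qed.

Lemma quadratic_neq0 (a b c : R) : (a != 0) || (b != 0) ->
  eventually (fun t => a * t ^+ 2 + b * t + c != 0).
Proof.
have pos (a' b' c' : R) : 0 < a' ->
    eventually (fun t => a' * t ^+ 2 + b' * t + c' != 0).
  by move=> /(quadratic_gt0 b' c')[M hM]; exists M => t /hM /lt0r_neq0.
have nz (a' b' c' : R) : a' != 0 ->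
    eventually (fun t => a' * t ^+ 2 + b' * t + c' != 0).
  rewrite neq_lt => /orP[a0|]; last exact: pos.
  have [|M hM] := pos (- a') (- b') (- c'); first by rewrite oppr_gt0.
  by exists M => t /hM; rewrite !mulNr -!opprD oppr_eq0.
have [-> /= b0|a0 _] := eqVneq a 0; last exact: nz.
(* For a = 0, multiply b t + c by t to have a leading term of degree 2. *)
have [M hM] := nz b c 0 b0; exists M => t /hM.
apply: contra => /eqP h; apply/eqP.
by rewrite -(mulr0 t) -[in RHS]h; ring.
Qed.

(** With d = v - u and n the rotation of d to the left, the point
    p t = u + e t^2 d + t n does the job for large t.  It is on the left of uv.
    Since t^2 dominates t, it is on the side of each line not parallel to d into
    which e d points.  Since a line meets a parabola at most twice, p t
    eventually avoids every line through two points of s. *)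
Lemma far_point s u v (e : R) : u != v -> e ^+ 2 = 1 ->
  exists p, [/\ 0 < orient u v p,
    {in s &, forall x y, x != y -> orient x y p != 0} &
    {in s &, forall x y, 0 < e * cross x y u v -> 0 < orient x y p}].
Proof.
move=> nuv e1.
pose d0 := abscissa v - abscissa u; pose d1 := ordinate v - ordinate u.
have D0 : 0 < d0 ^+ 2 + d1 ^+ 2.
  rewrite lt0r addr_ge0 ?sqr_ge0// andbT.
  rewrite paddr_eq0 ?sqr_ge0// !sqrf_eq0 !subr_eq0 eq_sym (eq_sym (ordinate v)).
  by rewrite -point_eq.
pose p t := point (abscissa u + e * t ^+ 2 * d0 - t * d1)
                  (ordinate u + e * t ^+ 2 * d1 + t * d0).
pose n x y := (abscissa y - abscissa x) * d0 + (ordinate y - ordinate x) * d1.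
have pE x y t : orient x y (p t) =
    e * cross x y u v * t ^+ 2 + n x y * t + orient x y u.
  rewrite /orient /cross abscissa_point ordinate_point /n /d0 /d1; ring.
have puv t : orient u v (p t) = t * (d0 ^+ 2 + d1 ^+ 2).
  rewrite /orient /cross abscissa_point ordinate_point /d0 /d1; ring.
have [M hM] : eventually (fun t => {in [seq (x, y) | x <- s, y <- s],
    forall w, (w.1 != w.2 -> orient w.1 w.2 (p t) != 0) /\
      (0 < e * cross w.1 w.2 u v -> 0 < orient w.1 w.2 (p t))}).
  apply: eventually_all => -[x y] _ /=.
  have [N hN] : eventually (fun t => x != y -> orient x y (p t) != 0).
    have [->|nxy] := eqVneq x y; first by exists 0.
    (* The coefficients of t^2 and t are the determinant and the inner product
       of y - x with d up to sign; they cannot both vanish, by Lagrange's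
       identity. *)
    have [|N hN] := @quadratic_neq0 (e * cross x y u v) (n x y) (orient x y u).
      rewrite -negb_and; apply: contra nxy => /andP[/eqP hc /eqP hn].
      have : (e * cross x y u v) ^+ 2 + n x y ^+ 2 = 0.
        by rewrite hc hn expr0n addr0.
      have -> : (e * cross x y u v) ^+ 2 + n x y ^+ 2 =
        ((abscissa y - abscissa x) ^+ 2 + (ordinate y - ordinate x) ^+ 2) *
        (d0 ^+ 2 + d1 ^+ 2).
        by rewrite exprMn e1 /cross /n -/d0 -/d1; ring.
      move=> /eqP; rewrite mulf_eq0 (gt_eqF D0) orbF.
      rewrite paddr_eq0 ?sqr_ge0// !sqrf_eq0 !subr_eq0.
      by rewrite eq_sym (eq_sym (ordinate y)) -point_eq.
    by exists N => t ht _; rewrite pE; exact: hN.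
  have [N' hN'] : eventually (fun t => 0 < e * cross x y u v ->
      0 < orient x y (p t)).
    have [c0|c0] := ltP 0 (e * cross x y u v); last by exists 0.
    have [N' hN'] := quadratic_gt0 (n x y) (orient x y u) c0.
    by exists N' => t ht _; rewrite pE; exact: hN'.
  exists (Num.max N N') => t; rewrite gt_max => /andP[Nt Nt'].
  by split; [exact: hN | exact: hN'].
pose t := Num.max M 0 + 1.
have Mt : M < t by rewrite /t ltr_pwDr// le_max lexx.
have t0 : 0 < t by rewrite /t ltr_pwDr// le_max lexx orbT.
exists (p t); split; first by rewrite puv mulr_gt0.
- by move=> x y xs ys; have [] := hM t Mt (x, y) (allpairs_f pair xs ys).
- by move=> x y xs ys; have [] := hM t Mt (x, y) (allpairs_f pair xs ys).
Qed.

(** Two applications of [far_point], towards - d and then towards d; the second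
    also avoids the lines through the first new point. *)
Lemma far_pair s u v : general_position s -> u \in s -> v \in s -> u != v ->
  exists p q, [/\ general_position [:: p, q & s],
    0 < orient u v p, 0 < orient u v q &
    {in s &, forall x y, cross x y u v != 0 ->
      (0 < orient x y p) = ~~ (0 < orient x y q)}].
Proof.
move=> gs us vs nuv.
have [q [uvq gq farq]] := @far_point s u v (-1) nuv ltac:(by rewrite sqrrN expr1n).
have gqs := general_position_cons us vs nuv gs gq.
have [p [uvp gp farp]] := @far_point (q :: s) u v 1 nuv (expr1n _ _).
have sub x : x \in s -> x \in q :: s by move=> xs; rewrite inE xs orbT.
exists p, q; split=> //.
  exact: general_position_cons (sub _ us) (sub _ vs) nuv gqs gp.
move=> x y xs ys; rewrite neq_lt => /orP[] c0.
- have hq : 0 < orient x y q by apply: farq => //; rewrite mulN1r oppr_gt0.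
  have hp : 0 < orient y x p.
    by apply: farp; rewrite ?sub// mul1r cross_swap oppr_gt0.
  by rewrite hq; move: hp; rewrite orient_swap oppr_gt0 => /lt_gtF ->.
- have hp : 0 < orient x y p by apply: farp; rewrite ?sub// mul1r.
  have hq : 0 < orient y x q.
    by apply: farq => //; rewrite mulN1r cross_swap opprK.
  by rewrite hp; move: hq; rewrite orient_swap oppr_gt0 => /lt_gtF ->.
Qed.

(** An occurrence of (x, y) in L adds two points to the left of xy and none to
    the left of yx; any other pair of L adds one point to each side of xy.  The
    multiplicity of (y, x) is moved to the left of the equation to avoid
    subtraction of natural numbers. *)
Lemma add_far_pairs (T : finType) (b : T -> 'rV[R]_2) (L : seq (T * T)) :
  injective b -> general_position (codom b) ->
  (forall x y u v : T, x != y -> u != v ->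
    (x, y) != (u, v) -> (x, y) != (v, u) -> cross (b x) (b y) (b u) (b v) != 0) ->
  {in L, forall w, w.1 != w.2} ->
  exists s, [/\ general_position s, size s = (#|T| + 2 * size L)%N,
    (forall x : T, b x \in s) &
    forall x y : T, x != y ->
      (left_count (b x) (b y) s + count_mem (y, x) L)%N =
      (left_count (b x) (b y) (codom b) + size L + count_mem (x, y) L)%N].
Proof.
move=> inj_b gb nonpar; elim: L => [|[u v] L IHL] hL.
  exists (codom b); split=> //=; first by rewrite size_codom muln0 addn0.
    by move=> x; exact: codom_f.
  by move=> x y _; rewrite !addn0.
have [|s [gs ss bs cs]] := IHL; first by move=> w wL; apply: hL; rewrite inE wL orbT.
have nuv : u != v by apply: (hL (u, v)); exact: mem_head.
have nbuv : b u != b v by rewrite (inj_eq inj_b).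
have [p [q [gpq uvp uvq far]]] := far_pair gs (bs u) (bs v) nbuv.
exists [:: p, q & s]; split=> //=; first by rewrite ss mulnS addnCA.
  by move=> x; rewrite !inE bs !orbT.
move=> x y nxy; have := cs x y nxy; rewrite /left_count /=.
rewrite (eq_sym (u, v)) (eq_sym (u, v)).
have [[-> ->]|n1] := eqVneq (x, y) (u, v).
  have /negPf-> : (v, u) != (u, v) by rewrite xpair_eqE negb_and nuv orbT.
  by rewrite uvp uvq; lia.
have [[-> ->]|n2] := eqVneq (y, x) (u, v).
  rewrite orient_swap oppr_gt0 (lt_gtF uvp) orient_swap oppr_gt0 (lt_gtF uvq).
  by lia.
have n2' : (x, y) != (v, u) by rewrite !xpair_eqE andbC in n2 *.
have -> : 0 < orient (b x) (b y) p = ~~ (0 < orient (b x) (b y) q).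
  by apply: far => //; apply: nonpar.
by case: (0 < _) => /=; lia.
Qed.

End Plane.

(** * Initial points on a parabola *)

Definition parabola (R : realType) (a : R) := point a (a ^+ 2).

(** The product of the two horizontal displacements and of the difference of
    the slopes c + d and a + b. *)
Lemma cross_parabola (R : realType) (a b c d : R) :
  cross (parabola a) (parabola b) (parabola c) (parabola d) =
  (b - a) * (d - c) * (c + d - (a + b)).
Proof. by rewrite /cross !abscissa_point !ordinate_point; ring. Qed.

(** The larger exponent is determined by 2 ^ j < 2 ^ i + 2 ^ j < 2 ^ j.+1. *)
Lemma Sidon_pow2 (i j k l : nat) : i != j -> k != l ->
  (2 ^ i + 2 ^ j = 2 ^ k + 2 ^ l)%N -> (i, j) = (k, l) \/ (i, j) = (l, k).
Proof.
have main i' j' k' l' : (i' < j')%N -> (k' < l')%N ->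
    (2 ^ i' + 2 ^ j' = 2 ^ k' + 2 ^ l')%N -> (i', j') = (k', l').
  have lt_main a b c d : (a < b)%N -> (b < d)%N -> (2 ^ a + 2 ^ b < 2 ^ c + 2 ^ d)%N.
    move=> ab bd; have : (2 ^ a < 2 ^ b)%N by rewrite ltn_exp2l.
    have : (2 ^ b.+1 <= 2 ^ d)%N by rewrite leq_exp2l.
    by rewrite expnS; lia.
  move=> ij kl E; have [jl|lj|jl] := ltngtP j' l'.
  - by have := lt_main _ _ k' _ ij jl; rewrite E ltnn.
  - by have := lt_main _ _ i' _ kl lj; rewrite E ltnn.
  - rewrite jl in E *; move/addIn/eqP: E; rewrite eqn_exp2l// => /eqP -> //.
move=> nij nkl E; case: (ltngtP i j) nij => // ij _; case: (ltngtP k l) nkl => // kl _.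
- by left; exact: main ij kl E.
- by right; apply: main ij kl _; rewrite E addnC.
- by right; have [-> ->] := main _ _ _ _ ij kl (etrans (addnC _ _) E).
- have [-> ->] := main _ _ _ _ ij kl (etrans (addnC _ _) (etrans E (addnC _ _))).
  by left.
Qed.

Lemma base_points (R : realType) (T : finType) : exists b : T -> 'rV[R]_2,
  [/\ injective b, general_position (codom b) &
  forall x y u v : T, x != y -> u != v ->
    (x, y) != (u, v) -> (x, y) != (v, u) -> cross (b x) (b y) (b u) (b v) != 0].
Proof.
pose a (x : T) : R := (2 ^ enum_rank x)%:R.
have inj_a : injective a.
  move=> x y /eqP; rewrite eqr_nat eqn_exp2l// => /eqP.
  by move=> /val_inj /enum_rank_inj.
have nz x y : x != y -> a y - a x != 0 by rewrite subr_eq0 (inj_eq inj_a) eq_sym.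
pose b x := parabola (a x).
have inj_b : injective b.
  by move=> x y /(congr1 (@abscissa R)); rewrite !abscissa_point => /inj_a.
exists b; split=> //.
  split; first by rewrite map_inj_uniq ?enum_uniq.
  move=> _ _ _ /codomP[x ->] /codomP[y ->] /codomP[z ->].
  rewrite !(inj_eq inj_b) => nxy nyz nxz; rewrite /orient cross_parabola.
  rewrite !mulf_neq0 ?nz// (_ : _ - _ = a z - a y) ?nz//; ring.
move=> x y u v nxy nuv n1 n2; rewrite cross_parabola !mulf_neq0 ?nz//.
rewrite -!natrD subr_eq0 eqr_nat; apply/eqP => E.
have inj_r x' y' : enum_rank x' = enum_rank y' :> nat -> x' = y' :> T.
  by move=> /val_inj /enum_rank_inj.
have nr x' y' : x' != y' :> T -> enum_rank x' != enum_rank y' :> nat.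
  by apply: contra => /eqP /inj_r ->.
have [[/inj_r xu /inj_r yv]|[/inj_r xv /inj_r yu]] :=
  Sidon_pow2 (nr _ _ nxy) (nr _ _ nuv) (esym E).
- by rewrite xu yv eqxx in n1.
- by rewrite xv yu eqxx in n2.
Qed.

(** * Counting edges and non-edges *)

Lemma seq_of_multiplicity (T : finType) (m : T -> nat) :
  exists L : seq T, (forall x, count_mem x L = m x) /\ size L = (\sum_x m x)%N.
Proof.
exists (flatten [seq nseq (m x) x | x : T]); split=> [x|].
  rewrite count_flatten sumnE !big_map -enumT big_enum /= (bigD1 x)//= big1.
    by rewrite count_nseq /= eqxx mul1n addn0.
  by move=> y /negPf nyx; rewrite count_nseq /= nyx.
rewrite size_flatten sumnE !big_map -enumT big_enum /=.
by apply: eq_bigr => x _; rewrite size_nseq.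
Qed.

(** Any strict total order would do: it selects one orientation of each
    unordered pair. *)
Definition rank_lt (T : finType) (w : T * T) : bool :=
  (enum_rank w.1 < enum_rank w.2)%N.

Lemma rank_lt_total (T : finType) (x y : T) : x != y ->
  rank_lt (y, x) = ~~ rank_lt (x, y).
Proof.
rewrite /rank_lt /= -leqNgt [in RHS]leq_eqVlt => nxy.
suff /negPf-> : enum_rank y != enum_rank x :> nat by [].
by rewrite eq_sym; apply: contra nxy => /eqP /val_inj /enum_rank_inj ->.
Qed.

Lemma sum_rank_lt (T : finType) (F : T * T -> nat) : (forall x, F (x, x) = 0%N) ->
  (\sum_w F w = \sum_(w | rank_lt w) (F w + F (w.2, w.1)))%N.
Proof.
move=> F0; rewrite (bigID (@rank_lt T)) big_split /=; congr addn.
rewrite [RHS](reindex_inj (h := fun w : T * T => (w.2, w.1))) /=; last first.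
  by move=> [? ?] [? ?] [-> ->].
rewrite (bigID (fun w : T * T => w.1 == w.2)) /= big1 ?add0n; last first.
  by move=> [x y] /= /andP[_ /eqP ->].
apply: eq_big => [[x y]|[x y]] //=; have [->|nxy] := eqVneq x y.
  by rewrite andbF /rank_lt ltnn.
by rewrite andbT (rank_lt_total nxy).
Qed.

Lemma card_edge_set (G : sgraph) :
  #|edge_set G| = #|[set w : G * G | rank_lt w & adj w.1 w.2]|.
Proof.
have <- : [set [set w.1; w.2] | w in [set w : G * G | rank_lt w & adj w.1 w.2]]
    = edge_set G.
  apply/setP => A; apply/imsetP/imsetP => -[[x y] + ->]; rewrite inE /=.
    by move=> /andP[_ xy]; exists (x, y); rewrite ?inE.
  move=> xy; have nxy : x != y by apply: contraTneq xy => ->; rewrite adj_irrefl.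
  have [lt_xy|] := boolP (rank_lt (x, y)); first by exists (x, y); rewrite ?inE ?lt_xy.
  rewrite -rank_lt_total// => lt_yx; exists (y, x); last by rewrite /= setUC.
  by rewrite inE lt_yx /= adj_sym.
apply: card_in_imset => -[x y] [u v]; rewrite !inE /= => /andP[lxy _] /andP[luv _].
move=> /setP E.
have := E x; have := E y; rewrite !inE !eqxx orbT /=.
move=> /esym/orP[]/eqP ? /esym/orP[]/eqP ?; subst=> //.
all: by move: lxy luv; rewrite /rank_lt /=; lia.
Qed.

(** Both sides count the edges of the complete graph on T. *)
Lemma card_rank_lt (T : finType) : #|[set w : T * T | rank_lt w]| = 'C(#|T|, 2).
Proof.
have neq_sym : symmetric (fun x y : T => x != y) by move=> x y; rewrite eq_sym.
have neq_irr : irreflexive (fun x y : T => x != y) by move=> x; rewrite eqxx.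
have -> : [set w : T * T | rank_lt w] =
    [set w : T * T | rank_lt w & w.1 != w.2].
  apply/setP => -[x y]; rewrite !inE /=; case: eqVneq => [->|_]; last by rewrite andbT.
  by rewrite /rank_lt ltnn.
rewrite -(card_edge_set (SGraph neq_sym neq_irr)) -card_draws.
apply: eq_card => A; rewrite inE; apply/imsetP/cards2P.
  by move=> [[x y]]; rewrite inE /= => nxy ->; exists x, y.
by move=> [x [y [nxy ->]]]; exists (x, y); rewrite ?inE.
Qed.

(** The two ordered pairs over an edge, or over a non-edge, are bounded together:
    for corrections only one of them is ever nonzero, so bounding them apart
    would lose a factor 2. *)
Lemma sum_edges_nonedges (G : sgraph) (F : G * G -> nat) (a c : nat) :
  (forall x, F (x, x) = 0%N) ->
  (forall x y, adj x y -> (F (x, y) + F (y, x) <= a)%N) ->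
  (forall x y, ~~ adj x y -> (F (x, y) + F (y, x) <= c)%N) ->
  (\sum_w F w <= #|edge_set G| * a + ('C(#|G|, 2) - #|edge_set G|) * c)%N.
Proof.
move=> F0 Fa Fc; rewrite (sum_rank_lt F0).
have -> : ('C(#|G|, 2) - #|edge_set G|)%N =
    #|[set w : G * G | rank_lt w & ~~ adj w.1 w.2]|.
  rewrite -card_rank_lt card_edge_set.
  rewrite -(cardsID [set w | adj w.1 w.2] [set w : G * G | rank_lt w]).
  rewrite (_ : _ :&: _ = [set w | rank_lt w & adj w.1 w.2]) ?addKn.
    by apply: eq_card => w; rewrite !inE andbC.
  by apply/setP => w; rewrite !inE.
rewrite card_edge_set -!sum_nat_const (bigID (fun w => adj w.1 w.2)) /=.
apply: leq_add.
  rewrite [leqRHS](eq_bigl (fun w => rank_lt w && adj w.1 w.2)).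
    by apply: leq_sum => -[x y] /andP[_ /Fa].
  by move=> w; rewrite inE.
rewrite [leqRHS](eq_bigl (fun w => rank_lt w && ~~ adj w.1 w.2)).
  by apply: leq_sum => -[x y] /andP[_ /Fc].
by move=> w; rewrite inE.
Qed.

Theorem theorem5p8 (R : realType) (k e : nat) (H : sgraph)
    (hk : (1 <= k)%N) (hV : #|H| = (2 * k)%N) (hE : #|edge_set H| = e) :
  exists G : sgraph,
    [/\ underlying_graph R G,
        #|G|%:Z <= 2 * k%:Z + 2 * e%:Z * k%:Z - 4 * e%:Z
                   + 2 * 'C(2 * k, 2)%:Z &
        contains_induced G H].
Proof.
have [b [inj_b gb nonpar]] := base_points R H.
pose l x y := left_count (b x) (b y) (codom b).
have l_sum x y : x != y -> (l x y + l y x + 2 = 2 * k)%N.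
  move=> nxy; rewrite left_count_sum ?codom_f// ?(inj_eq inj_b)//.
  by rewrite size_codom.
(* Number of corrections of the directed line w. The truncated subtraction
   puts all corrections of an edge on its poorer side. *)
pose m (w : H * H) : nat :=
  if w.1 == w.2 then 0%N else
  if adj w.1 w.2 then ((l w.2 w.1 - l w.1 w.2) %/ 2)%N
  else (l w.1 w.2 == l w.2 w.1) && rank_lt w.
have m_diag x : m (x, x) = 0%N by rewrite /m eqxx.
have [L [countL sizeL]] := seq_of_multiplicity m.
have [|s [gs size_s bs left_s]] := add_far_pairs (L := L) inj_b gb nonpar.
  move=> [x y] /=; apply: contraTneq => ->.
  by rewrite -has_pred1 has_count countL m_diag.
have le_L : (size L <= e * (k - 1) + ('C(2 * k, 2) - e))%N.
  rewrite -hV -hE sizeL -[X in (_ <= _ + X)%N]muln1.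
  apply: sum_edges_nonedges => // x y.
    move=> xy; have nxy : x != y by apply: contraTneq xy => ->; rewrite adj_irrefl.
    rewrite /m /= (negPf nxy) (eq_sym y) (negPf nxy) (adj_sym y) xy.
    by have := l_sum x y nxy; lia.
  move=> /negPf xy; have [->|nxy] := eqVneq x y; first by rewrite m_diag.
  rewrite /m /= (negPf nxy) (eq_sym y) (negPf nxy) (adj_sym y) xy (rank_lt_total nxy).
  by rewrite eq_sym; case: (_ == _) => //=; case: rank_lt.
have le_e : (e <= 'C(2 * k, 2))%N.
  rewrite -hE -hV card_edge_set -card_rank_lt; apply: subset_leq_card.
  by apply/subsetP => w; rewrite !inE => /andP[].
have size_s' : size s = (2 * (k + size L))%N by rewrite size_s hV mulnDr.
have [|G [underG cardG embG]] := halving_graph gs; first by rewrite size_s' mul2n odd_double.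
exists G; split=> //; first by rewrite cardG size_s'; nia.
have [f [inj_f adj_f]] := embG _ b inj_b bs.
exists f; split=> // x y; rewrite adj_f.
have [->|nxy] := eqVneq x y; first by rewrite adj_irrefl.
have := left_s x y nxy; have := left_s y x; rewrite eq_sym => /(_ nxy).
rewrite -/(l x y) -/(l y x) !countL /m /= (negPf nxy) (eq_sym y) (negPf nxy).
rewrite (adj_sym y x) (rank_lt_total nxy).
have := l_sum x y nxy.
case: adj => /=; first by lia.
by rewrite (eq_sym (l y x)); have [E|] := eqVneq (l x y) (l y x); case: rank_lt => /=; lia.
Qed.
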